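(* Let $U,L\in\mathcal{P}(n,d)$ with $U$ weakly above $L$, and let $\Lambda=\Lambda_{M[U,L]}$. Then $\mathrm{st}_L(C)=\Lambda(\mathcal{E}(C))$ for all $C\in\mathcal{P}[U,L]$. In particular, \[ \mathcal{S}_{\mathsf{lex}}(M[U,L])=\{\mathrm{st}_L(C):C\in\mathcal{P}[U,L]\}. \]
   Context: $\mathcal{P}(n,d)$ is the set of words $C=C_1\cdots C_n$ in letters $\mathbf{e}$ (east step $(1,0)$) and $\mathbf{n}$ (north step $(0,1)$) with exactly $d$ letters $\mathbf{e}$, viewed as lattice paths from $(0,0)$ to $(d,n-d)$; the realization of the $i$-th step is the unit segment it traverses. $\mathcal{E}(C)=\{i:C_i=\mathbf{e}\}$. $U$ is weakly above $L$ if every prefix $L_1\cdots L_k$ has at least as many $\mathbf{e}$'s as $U_1\cdots U_k$. $\mathcal{P}[U,L]$ is the set of $C\in\mathcal{P}(n,d)$ weakly below $U$ and weakly above $L$; $M[U,L]$ is the matroid on $[n]$ with bases $\{\mathcal{E}(C):C\in\mathcal{P}[U,L]\}$. Statistic: for $C$ weakly above $L$, the $L$-demarcation path $D$ starts at $(0,0)$ and its $i$-th step is $\mathbf{n}$ if $C_i=L_i=\mathbf{n}$; $\mathbf{e}$ if $C_i=L_i=\mathbf{e}$; a diagonal step $(1,1)$ if $C_i=\mathbf{n},L_i=\mathbf{e}$; empty if $C_i=\mathbf{e},L_i=\mathbf{n}$. The $L$-marking path $P$ goes from $(0,0)$ to $(d,n-d)$ with steps $(1,1)$, $(1,0)$,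 $(0,1)$: it uses a diagonal step whenever possible without going above $C$ or below $D$; if a diagonal step would go above $C$ it uses an east step instead, and if it would go below $D$ it uses a north step instead. An east step $C_i$ is marked if its realization is also an east step of $P$; $\mathrm{st}_L(C)\subseteq\mathcal{E}(C)$ is the set of indices of unmarked east steps of $C$. $\mathcal{S}_{\mathsf{lex}}(M)$ for a matroid $M$ on finite $E\subset\mathbb{N}$: $\{\tau\subseteq E:\prod_{i\in\tau}x_i\notin\mathrm{in}(I(V_M))\}$ where $V_M=\{\mathbf{e}_B:B$ basis$\}$, $I(V_M)\subseteq\mathbb{R}[x_e:e\in E]$ its vanishing ideal, initial ideal for lex order with $x_e\succ x_f$ for $e<f$ ($\{\emptyset\}$ if $E=\emptyset$). $\{\Lambda_M\}$ is the unique family of bijections $\Lambda_M:\mathcal{B}(M)\to\mathcal{S}_{\mathsf{lex}}(M)$ over all matroids with ground set a finite subset of $\mathbb{N}$ such that for $M$ with nonempty ground set, largest element $m$, and basis $B$: $\Lambda_M(B)\subseteq B$; $\Lambda_M(B)=\Lambda_{M\backslash m}(B)$ if $m\notin B$; $\Lambda_M(B)\setminus\{m\}=\Lambda_{M/m}(B\setminus\{m\})$ if $m\in B$. *)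

(* Defs.v *)
From HB Require Import structures.
From mathcomp Require Import all_boot all_order all_algebra.
From mathcomp Require Import finmap.
From mathcomp Require Import mpoly.
From mathcomp Require Import Rstruct.

Set Implicit Arguments.
Unset Strict Implicit.
Unset Printing Implicit Defensive.

Local Open Scope fset_scope.

(* Lattice paths.  A word C = C_1 ... C_n in {e, n} is an n.-tuple bool, *)
(* with  true = e (east step (1,0))  and  false = n (north step (0,1)).  *)
(* The i-th letter (1-based) is  nth false C (i-1).                      *)

Definition neast (C : seq bool) (k : nat) : nat := count id (take k C).
Definition nnorth (C : seq bool) (k : nat) : nat := count negb (take k C).

Definition inP (n d : nat) (C : n.-tuple bool) : bool := count id C == d.

Definition weakly_above (n : nat) (U L : n.-tuple bool) : bool :=
  all (fun k => neast U k <= neast L k) (iota 0 n.+1).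

Definition inPUL (n d : nat) (U L C : n.-tuple bool) : bool :=
  [&& inP d C, weakly_above U C & weakly_above C L].

Definition Eset (n : nat) (C : n.-tuple bool) : {fset nat} :=
  [fset j.+1 | j in iota 0 n & nth false C j].

Definition epos (C : seq bool) (x : nat) : nat :=
  find (fun i => neast C i.+1 == x.+1) (iota 0 (size C)).

(* height at which C leaves column x, i.e. y-coordinate of the east step of
   C from column x to column x+1 *)
Definition hC (C : seq bool) (x : nat) : nat := nnorth C (epos C x).

(* height at which the L-demarcation path D leaves column x.  The vertex of
   D after k steps is (neast L k, nnorth C k); D leaves column x at the
   (x+1)-th letter e of L (by an east step if C has e there, by a diagonal
   step if C has n there), starting at height nnorth C (epos L x). *)
Definition hD (L C : seq bool) (x : nat) : nat := nnorth C (epos L x).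

(* The L-marking path P, built greedily from (x,y); the function returns the
   list of starting points of the east steps of P.
   - diagonal step (1,1) if it stays weakly below C and weakly above D;
   - if the diagonal step would go above C (y+1 > hC x) : east step;
   - if it would go below D (y < hD x) : north step;
   - once x = d (P is on the last column) only north steps remain. *)
Fixpoint mpath (d h : nat) (hc hd : nat -> nat) (fuel x y : nat)
  : seq (nat * nat) :=
  match fuel with
  | 0 => [::]
  | f.+1 =>
    if (x == d) && (y == h) then [::]
    else if d <= x then mpath d h hc hd f x y.+1
    else if hc x < y.+1 then (x, y) :: mpath d h hc hd f x.+1 y
    else if y < hd x then mpath d h hc hd f x y.+1
    else mpath d h hc hd f x.+1 y.+1
  end.

(* east-step starting points of the L-marking path of C (n steps of fuel
   suffice since each step increases x+y) *)
Definition marking_east (n : nat) (L C : n.-tuple bool) : seq (nat * nat) :=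
  let d := count id C in
  mpath d (n - d) (hC C) (hD L C) n 0 0.

(* st_L(C) : indices of the unmarked east steps of C.  The i-th step of C
   (0-based j = i-1) starts at (neast C j, nnorth C j); an east step is
   marked iff that unit east segment is an east step of P. *)
Definition stL (n : nat) (L C : n.-tuple bool) : {fset nat} :=
  [fset j.+1 | j in iota 0 n &
     nth false C j && ((neast C j, nnorth C j) \notin marking_east L C)].

Definition is_matroid (E : {fset nat}) (Bs : {fset {fset nat}}) : Prop :=
  [/\ Bs != fset0,
      (forall B, B \in Bs -> B `<=` E) &
      (forall B1 B2, B1 \in Bs -> B2 \in Bs -> forall x, x \in B1 `\` B2 ->
         exists2 y, y \in B2 `\` B1 & (B1 `\ x) `|` [fset y] \in Bs)].

(* deletion M \ m (if m is a coloop, M \ m = M / m) *)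
Definition del_bases (Bs : {fset {fset nat}}) (m : nat) : {fset {fset nat}} :=
  if has (fun B => m \notin B) Bs then [fset B | B in Bs & m \notin B]
  else [fset B `\ m | B in Bs].

(* contraction M / m (if m is a loop, M / m = M \ m) *)
Definition con_bases (Bs : {fset {fset nat}}) (m : nat) : {fset {fset nat}} :=
  if has (fun B => m \in B) Bs then [fset B `\ m | B in Bs & m \in B]
  else Bs.

(* S_lex(M).  Variables x_e (e in E) are indexed by 'I_k, k = #|E|,     *)
(* variable i <-> the i-th smallest element of E; polynomials are in    *)
(* R[x_e : e in E] with R the real numbers.                              *)

Definition RR := Rdefinitions.R.

Section Slex.
Variables (E : {fset nat}) (Bs : {fset {fset nat}}).

Definition gsort : seq nat := sort leq E.
Definition gk : nat := size gsort.
Definition gelt (i : 'I_gk) : nat := nth 0 gsort i.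

Definition evec (B : {fset nat}) : 'I_gk -> RR :=
  fun i => (((gelt i \in B) : nat)%:R)%R.

Definition vanishing (f : {mpoly RR[gk]}) : Prop :=
  forall B, B \in Bs -> f.@[evec B] = 0%R.

(* lexicographic order on monomials with x_e > x_f for e < f, i.e. the
   variable with smallest index is the most significant:  m1 <lex m2 *)
Definition lexlt (m1 m2 : 'X_{1..gk}) : Prop :=
  exists i : 'I_gk, (forall j : 'I_gk, (j < i)%N -> m1 j = m2 j) /\
                    (m1 i < m2 i)%N.

Definition is_lead (f : {mpoly RR[gk]}) (m : 'X_{1..gk}) : Prop :=
  m \in msupp f /\ (forall m', m' \in msupp f -> m' != m -> lexlt m' m).

Definition in_initial (p : {mpoly RR[gk]}) : Prop :=
  exists r : seq ({mpoly RR[gk]} * {mpoly RR[gk]} * 'X_{1..gk}),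
    (forall t, t \in r -> vanishing t.1.2 /\ is_lead t.1.2 t.2) /\
    p = (\sum_(t <- r) t.1.1 * 'X_[t.2])%R.

Definition sqmono (tau : {fset nat}) : 'X_{1..gk} :=
  [multinom ((gelt i \in tau) : nat) | i < gk].

Definition Slex (tau : {fset nat}) : Prop :=
  if E == fset0 then tau = fset0
  else tau `<=` E /\ ~ in_initial 'X_[sqmono tau].

End Slex.

Definition lam_family := {fset nat} -> {fset {fset nat}} -> {fset nat} -> {fset nat}.

Definition is_Lambda_family (Lam : lam_family) : Prop :=
  forall E Bs, is_matroid E Bs ->
    [/\ (forall B, B \in Bs -> Slex E Bs (Lam E Bs B)),
        {in Bs &, injective (Lam E Bs)},
        (forall tau, Slex E Bs tau -> exists2 B, B \in Bs & Lam E Bs B = tau) &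
        (E != fset0 ->
         let m := \max_(e <- E) e in
         forall B, B \in Bs ->
           [/\ Lam E Bs B `<=` B,
               (m \notin B -> Lam E Bs B = Lam (E `\ m) (del_bases Bs m) B) &
               (m \in B -> Lam E Bs B `\ m =
                           Lam (E `\ m) (con_bases Bs m) (B `\ m))])].

Definition ground (n : nat) : {fset nat} := [fset j.+1 | j in iota 0 n].

Definition MUL_bases (n d : nat) (U L : n.-tuple bool) : {fset {fset nat}} :=
  [fset Eset C | C in [seq C <- enum {: n.-tuple bool} | inPUL d U L C]].

(* Main.v *)
Require Import Defs.
From HB Require Import structures.
From mathcomp Require Import all_boot all_order all_algebra.
From mathcomp Require Import finmap.
From mathcomp Require Import mpoly.
From mathcomp Require Import Rstruct.
From mathcomp Require Import zify ring.

(** Read [C] from left to right. At each moment some columns have been entered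
    by [L] but not yet left by [C]; the [L]-marking path takes its diagonal
    steps greedily, so each north step of [C] serves the first such column not
    served before, and an east step of [C] is unmarked exactly when the column
    it leaves has been served. Hence [st_L] is computed by an automaton whose
    state is the number [m] of served columns not yet left. Two facts compare
    the prefixes that can precede the last letter: a prefix with [m > 0] has
    the same statistic as some prefix with one more east step, and this fails
    when [m = 0]. On the algebraic side, evaluating the last variable at 0 and
    1 shows that, for every set [V] of 0/1-points, [t] without the last element
    [z] is standard iff it is standard for the deletion or for the contraction
    of [z], and [z |` t] is standard iff [t] is standard for both. The two facts
    are this same recursion for the values of [st_L], and together with
    injectivity they force the recursion of [Lambda]. *)

Set Implicit Arguments.
Unset Strict Implicit.
Unset Printing Implicit Defensive.

Import GRing.Theory.
Local Open Scope fset_scope.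
Local Open Scope nat_scope.

(** * Words and the marking automaton *)

Section Words.
Variables lo hi : nat -> nat.

(* Words are read backwards (head = last letter), so that prefixes are tails;
   [lo] and [hi] bound the number of east steps of each nonempty prefix. *)
Fixpoint admissible (w : seq bool) : bool :=
  if w is b :: w' then
    admissible w' && (lo (size w').+1 <= b + count id w' <= hi (size w').+1)
  else true.

(* Number of columns entered by the lower path and not yet left by [w] on which
   the marking path takes a diagonal step. *)
Fixpoint pending (w : seq bool) : nat :=
  if w is b :: w' then
    if b then (pending w').-1
    else minn (pending w').+1 (hi (size w').+1 - count id w')
  else 0.

Fixpoint unmarked (w : seq bool) : {fset nat} :=
  if w is b :: w' then
    if b && (0 < pending w') then (size w').+1 |` unmarked w' else unmarked w'
  else fset0.

Fixpoint easts (w : seq bool) : {fset nat} :=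
  if w is b :: w' then
    if b then (size w').+1 |` easts w' else easts w'
  else fset0.

Lemma in_easts b w x :
  (x \in easts (b :: w)) = b && (x == (size w).+1) || (x \in easts w).
Proof. by case: b; rewrite //= in_fset1U. Qed.

Lemma in_unmarked b w x :
  (x \in unmarked (b :: w)) =
  [&& b, 0 < pending w & x == (size w).+1] || (x \in unmarked w).
Proof. by case: b => //=; case: ifP => //=; rewrite in_fset1U. Qed.

Lemma easts_le w x : x \in easts w -> 0 < x <= size w.
Proof.
elim: w => [|b w IHw]; first by rewrite inE.
by rewrite in_easts => /orP[/andP[_ /eqP->] /=|/IHw] //=; lia.
Qed.

Lemma easts_last w : (size w).+1 \in easts w = false.
Proof. by apply/negP => /easts_le; rewrite ltnn. Qed.

Lemma unmarked_le w x : x \in unmarked w -> 0 < x <= size w.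
Proof.
elim: w => [|b w IHw]; first by rewrite inE.
by rewrite in_unmarked => /orP[/and3P[_ _ /eqP->] /=|/IHw] //=; lia.
Qed.

Lemma unmarked_last w : (size w).+1 \in unmarked w = false.
Proof. by apply/negP => /unmarked_le; rewrite ltnn. Qed.

(** The position of the head letter exceeds every element contributed by the tail, so its membership
    can be read off separately. *)
Lemma unmarked_cons_inj b1 w1 b2 w2 : size w1 = size w2 ->
  unmarked (b1 :: w1) = unmarked (b2 :: w2) ->
  b1 && (0 < pending w1) = b2 && (0 < pending w2) /\ unmarked w1 = unmarked w2.
Proof.
move=> sz E; split.
  have := in_unmarked b1 w1 (size w1).+1; have := in_unmarked b2 w2 (size w2).+1.
  rewrite !unmarked_last eqxx !andbT !orbF E sz eqxx !andbT.
  by move=> -> ->.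
apply/fsetP => x.
have := congr1 (fun A => (x != (size w1).+1) && (x \in A)) E.
rewrite !in_unmarked sz; case: eqP => [->|_] /=; last by rewrite !andbF.
by rewrite -{1}sz !unmarked_last.
Qed.

Hypothesis hi_mono : forall k, hi k <= hi k.+1.

(** Pending columns and columns already left are disjoint, and all have been entered by the lower
    path. *)
Lemma pending_le w : admissible w -> pending w + count id w <= hi (size w).
Proof.
elim: w => [|b w IHw] //= /andP[/IHw le_w /andP[_ le_b]].
by have := hi_mono (size w); case: b le_b => /=; lia.
Qed.

(* [w'] turns the last north step met with [pending = 0] into an east step. *)
Lemma unmarked_add_east w : admissible w -> 0 < pending w ->
  exists w', [/\ size w' = size w, admissible w',
    count id w' = (count id w).+1, unmarked w' = unmarked w &
    pending w <= (pending w').+1].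
Proof.
elim: w => [|b w IHw] //= /andP[aw /andP[lo_w hi_w]].
have := hi_mono (size w); have := pending_le aw.
case: b lo_w hi_w => /= lo_w hi_w pw mw.
  move=> m_gt1; have m_gt0 : 0 < pending w by clear -m_gt1; lia.
  have [w' [sz aw' cw' uw' pw']] := IHw aw m_gt0.
  have m'_gt0 : 0 < pending w' by clear -m_gt1 pw'; lia.
  exists (true :: w'); rewrite /= sz aw' cw' uw' m_gt0 m'_gt0.
  by split=> //; clear -lo_w hi_w pw mw pw' m_gt1; lia.
case: (posnP (pending w)) => [p0|p_gt0] m_gt0.
  (* With no pending column an east step adds nothing to [unmarked]; [m_gt0] leaves room for it
     below [hi]. *)
  exists (true :: w); rewrite /= aw p0 /=.
  by split=> //; clear -lo_w hi_w m_gt0; lia.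
have [w' [sz aw' cw' uw' pw']] := IHw aw p_gt0.
exists (false :: w'); rewrite /= sz aw' cw' uw'.
by split=> //; clear -lo_w hi_w m_gt0 pw' mw pw; lia.
Qed.

(** [pending w + count id w] counts the columns served or left. For counts differing by one the
    inequality forces [0 < pending w1], the second of the two facts on prefixes; arbitrary gaps are
    allowed for the sake of the induction. *)
Lemma pending_antitone w1 w2 : size w1 = size w2 ->
  admissible w1 -> admissible w2 -> unmarked w1 = unmarked w2 ->
  count id w1 <= count id w2 ->
  pending w2 + count id w2 <= pending w1 + count id w1.
Proof.
move=> sz a1 a2 uu.
(* Both orders go through the induction together: when the head letters differ, the order of the
   counts of the tails is not determined. *)
suff: (count id w1 <= count id w2 ->
    pending w2 + count id w2 <= pending w1 + count id w1) /\
  (count id w2 <= count id w1 ->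
    pending w1 + count id w1 <= pending w2 + count id w2).
  by case.
elim: w1 w2 sz a1 a2 uu => [|b1 w1 IHw] [|b2 w2] // [sz].
move=> /= /andP[a1 /andP[_ h1]] /andP[a2 /andP[_ h2]].
move=> /(unmarked_cons_inj sz)[bb uu].
have := IHw w2 sz a1 a2 uu; have := pending_le a1; have := pending_le a2.
have := hi_mono (size w2); rewrite -sz in h2 *; clear -bb h1 h2.
by case: b1 bb h1; case: b2 h2 => /=; lia.
Qed.

(** * The exchange property of admissible words *)

Lemma easts_consD y b1 w1 b2 w2 : size w1 = size w2 ->
  y \in easts w2 `\` easts w1 ->
  y \in easts (b2 :: w2) `\` easts (b1 :: w1).
Proof.
move=> sz; rewrite !in_fsetD !in_easts => /andP[/negPf-> y2].
rewrite y2 orbT orbF andbT; apply/negP => /andP[_ /eqP y1].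
by move: y2; rewrite y1 sz easts_last.
Qed.

Lemma easts_consU y b w w' : size w' = size w ->
  easts w' = y |` easts w -> easts (b :: w') = y |` easts (b :: w).
Proof. by case: b => //= -> ->; rewrite fsetUCA. Qed.

Lemma easts_consB x b w w' : size w' = size w -> x \in easts w ->
  easts w' = easts w `\ x -> easts (b :: w') = easts (b :: w) `\ x.
Proof.
case: b => //= -> xw ->; apply/fsetP => z; rewrite !inE.
by have [->|//] := eqVneq z x; case: eqP xw => // ->; rewrite easts_last.
Qed.

(** The position from which on [w1] stays strictly behind [w2] carries a north step of [w1] and an
    east step of [w2]. Raising [w1] there is admissible, as the counts of [w2] bound the new
    ones. *)
Lemma easts_add w1 w2 : size w1 = size w2 ->
  admissible w1 -> admissible w2 -> count id w1 < count id w2 ->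
  exists y w, [/\ y \in easts w2 `\` easts w1, size w = size w1, admissible w,
    count id w = (count id w1).+1 & easts w = y |` easts w1].
Proof.
elim: w1 w2 => [|b1 w1 IHw] [|b2 w2] // [sz].
move=> /= /andP[a1 /andP[l1 h1]] /andP[a2 /andP[l2 h2]] c12.
have [c12'|c12'] := ltnP (count id w1) (count id w2).
  have [y [w [yE sw aw cw ew]]] := IHw w2 sz a1 a2 c12'.
  exists y, (b1 :: w); split; rewrite -?[X in _ \in X `\` _]/(easts (b2 :: w2)).
  - exact: (easts_consD b1 b2 sz yE).
  - by rewrite /= sw.
  - rewrite /= aw sw cw; rewrite -sz in h2; clear -l1 h1 c12 h2; lia.
  - by rewrite /= cw addnS.
  - exact: (easts_consU b1 sw ew).
case: b1 b2 l1 h1 l2 h2 c12 => [] [] /= l1 h1 l2 h2 c12;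
  try by exfalso; clear -c12 c12'; lia.
exists (size w2).+1, (true :: w1); split=> //=.
- by rewrite in_fsetD fset1U1 -sz easts_last.
- by rewrite a1; rewrite -sz in h2; clear -l1 h1 c12 c12' h2; lia.
- by rewrite sz.
Qed.

(** If [w2] is ahead before [x], then [easts_add] supplies an earlier [y]. Otherwise removing [x]
    lowers the later counts of [w1] by one, which is harmless while they exceed those of [w2]; the
    second alternative records this state, until the counts meet and provide a later [y]. *)
Lemma easts_exchange w1 w2 x : size w1 = size w2 ->
  admissible w1 -> admissible w2 -> x \in easts w1 `\` easts w2 ->
  (exists y w, [/\ y \in easts w2 `\` easts w1, size w = size w1, admissible w,
    count id w = count id w1 & easts w = y |` (easts w1 `\ x)]) \/
  (count id w2 < count id w1 /\
   exists w, [/\ size w = size w1, admissible w,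
    (count id w).+1 = count id w1 & easts w = easts w1 `\ x]).
Proof.
elim: w1 w2 => [|b1 w1 IHw] [|b2 w2] //; first by rewrite in_fsetD inE andbF.
case=> sz /= /andP[a1 /andP[l1 h1]] /andP[a2 /andP[l2 h2]].
rewrite -/(easts (b1 :: w1)) -/(easts (b2 :: w2)) => xE.
have [xl|xl] := eqVneq x (size w1).+1.
  have [b1E b2E] : b1 /\ ~~ b2.
    move: xE; rewrite in_fsetD !in_easts xl eqxx easts_last sz easts_last eqxx.
    by rewrite !andbT !orbF => /andP[].
  rewrite b1E in l1 h1 *; rewrite (negPf b2E) in l2 h2 *; rewrite /= in l1 h1 l2 h2.
  have eB : easts (true :: w1) `\ x = easts w1.
    by rewrite /= xl fsetU1K ?easts_last.
  have [c12|c12] := ltnP (count id w1) (count id w2); [left|right].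
    have [y [w [yE sw aw cw ew]]] := easts_add sz a1 a2 c12.
    exists y, (false :: w); rewrite eB; split.
    - exact: (easts_consD true false sz yE).
    - by rewrite /= sw.
    - by rewrite /= aw sw cw; clear -l1 h1; lia.
    - by rewrite /= cw.
    - by [].
  split; first by clear -c12 => /=; lia.
  exists (false :: w1); rewrite eB; split=> //=.
  by rewrite a1; rewrite -sz in l2; clear -l1 h1 l2 c12; lia.
have x1 : x \in easts w1.
  by move: xE; rewrite in_fsetD !in_easts (negPf xl) andbF => /andP[].
have xE' : x \in easts w1 `\` easts w2.
  by move: xE; rewrite !in_fsetD !in_easts x1 negb_or => /andP[/andP[_ ->]].
have [[y [w [yE sw aw cw ew]]]|[c12 [w [sw aw cw ew]]]] := IHw w2 sz a1 a2 xE'.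
  left; exists y, (b1 :: w); split.
  - exact: (easts_consD b1 b2 sz yE).
  - by rewrite /= sw.
  - by rewrite /= aw sw cw l1 h1.
  - by rewrite /= cw.
  - case: b1 {l1 h1 xE} => //=; rewrite sw ew fsetUCA; congr (_ |` _).
    by apply/fsetP => z; rewrite !inE; case: eqP => // ->; rewrite eq_sym xl.
have eB : easts (b1 :: w) = easts (b1 :: w1) `\ x by apply: easts_consB.
have [c12'|c12'] := ltnP (b2 + count id w2) (b1 + count id w1); [right|left].
  split=> //; exists (b1 :: w); split=> //; rewrite /= ?sw -?cw ?addnS //.
  by rewrite aw; rewrite -sz in l2; clear -l1 h1 l2 c12' cw; lia.
(* The count of [w2] catches up here, so this position is the one exchanged for [x]. *)
have [/negPf b1E b2E] : ~~ b1 /\ b2.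
  by clear -c12 c12'; case: b1 c12'; case: b2 => /=; lia.
rewrite b1E in l1 h1 c12' *; rewrite b2E in l2 h2 c12' *.
exists (size w1).+1, (true :: w); split.
- by rewrite /= in_fsetD sz fset1U1 -sz easts_last.
- by rewrite /= sw.
- by rewrite /= aw sw; clear -l1 h1 cw; lia.
- by rewrite /= add1n cw.
- by rewrite /= sw ew.
Qed.

End Words.

(** * Standard monomials of sets of 0/1-points *)

Section Nonstandard.
Variable F : fieldType.
Implicit Types (E B s t : {fset nat}) (g : {fset nat} -> F).

(** The lexicographic order on squarefree monomials, given by their supports: the exponents first
    differ at [i]. *)
Definition slt s t : Prop :=
  exists i, [/\ i \in t, i \notin s & forall j, j < i -> (j \in s) = (j \in t)].

(** Linear combinations of the squarefree monomials below [t], as functions of the point [B]. The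
    equations are pointwise, so that the predicate respects pointwise equality without function
    extensionality. *)
Inductive lower_span E t : ({fset nat} -> F) -> Prop :=
| lower_span0 g : (forall B, g B = 0)%R -> lower_span E t g
| lower_span_cons c s g g' : s `<=` E -> slt s t -> lower_span E t g ->
    (forall B, g' B = c * (s `<=` B)%:R + g B)%R -> lower_span E t g'.

(* On 0/1-points a monomial depends only on its support [s], where it is the
   indicator of [s `<=` B]. *)
Definition nonstandard E (V : {fset nat} -> Prop) t : Prop :=
  exists2 g, lower_span E t g & forall B, V B -> ((t `<=` B)%:R = g B)%R.

Lemma lower_spanD E t g1 g2 : lower_span E t g1 -> lower_span E t g2 ->
  lower_span E t (fun B => g1 B + g2 B)%R.
Proof.
move=> s1 s2; elim: s1 => {g1} [g g0|c s g g' sE st _ IHg gE].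
  elim: s2 => {g2} [g' g'0|c s g2 g2' sE st _ IHg gE].
    by apply: lower_span0 => B; rewrite g0 g'0 addr0.
  by apply: (lower_span_cons sE st IHg (c := c)) => B; rewrite gE addrCA.
by apply: (lower_span_cons sE st IHg (c := c)) => B; rewrite gE addrA.
Qed.

Lemma lower_spanZ E t c g : lower_span E t g -> lower_span E t (fun B => c * g B)%R.
Proof.
elim=> {g} [g g0|a s g g' sE st _ IHg gE].
  by apply: lower_span0 => B; rewrite g0 mulr0.
by apply: (lower_span_cons sE st IHg (c := c * a)) => B; rewrite gE mulrDr mulrA.
Qed.

Lemma lower_span1 E t s : s `<=` E -> slt s t ->
  lower_span E t (fun B => (s `<=` B)%:R)%R.
Proof.
move=> sE st; have s0 : lower_span E t (fun=> 0%R) by exact: lower_span0.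
by apply: (lower_span_cons sE st s0 (c := 1%R)) => B; rewrite mul1r addr0.
Qed.

Lemma lower_span_eq E t g g' : lower_span E t g -> g =1 g' -> lower_span E t g'.
Proof.
case=> {g} [h h0|c s h h' sE st sh hE] gE.
  by apply: lower_span0 => B; rewrite -gE.
by apply: (lower_span_cons sE st sh (c := c)) => B; rewrite -gE.
Qed.

(** * Splitting off the least significant variable [x_m] *)

Variables (E : {fset nat}) (m : nat).
Hypothesis E_lt : forall x, x \in E -> x < m.

Lemma notin_ground : m \notin E.
Proof. by apply/negP => /E_lt; rewrite ltnn. Qed.

Lemma fsubset_top t B : t `<=` E -> (t `<=` B `\ m) = (t `<=` B).
Proof.
move=> tE; rewrite fsubsetD1.
by rewrite (contra (fsubsetP tE m) notin_ground) andbT.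
Qed.

Lemma fsubsetU1_top s B : (m |` s `<=` B) = (m \in B) && (s `<=` B).
Proof. by rewrite fsubUset fsub1set. Qed.

Lemma fsubset_addtop s B : (s `<=` m |` B) = (s `\ m `<=` B).
Proof. by rewrite fsubDset. Qed.

Lemma fsubD1_ground s : s `<=` m |` E -> s `\ m `<=` E.
Proof. by rewrite fsubDset. Qed.

(** The first difference is an element of [t], hence smaller than [m], so the presence of [m] does
    not affect the comparison. *)
Lemma slt_D1 s t : t `<=` E -> slt s t -> slt (s `\ m) t.
Proof.
move=> tE [i [it is_ ij]]; exists i; split=> // [|j ji].
  by rewrite in_fsetD1 negb_and is_ orbT.
have ltim := E_lt (fsubsetP tE _ it).
rewrite in_fsetD1 ij //; case: eqP => // jm.
by move: ltim; rewrite -jm ltnNge (ltnW ji).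
Qed.

Lemma slt_U1 s t : t `<=` E -> slt s t -> slt (m |` s) t.
Proof.
move=> tE [i [it is_ ij]]; have ltim := E_lt (fsubsetP tE _ it).
exists i; split=> // [|j ji]; rewrite in_fset1U.
  by rewrite negb_or is_ andbT neq_ltn ltim.
by rewrite ij // ltn_eqF ?(ltn_trans ji).
Qed.

Lemma slt_U1r s t : t `<=` E -> slt s t -> slt s (m |` t).
Proof.
move=> tE [i [it is_ ij]]; have ltim := E_lt (fsubsetP tE _ it).
exists i; split=> // [|j ji]; rewrite in_fset1U ?it ?orbT //.
by rewrite ij // ltn_eqF ?(ltn_trans ji).
Qed.

Lemma slt_U1l s t : t `<=` E -> slt s t -> slt (m |` s) (m |` t).
Proof.
move=> tE [i [it is_ ij]]; have ltim := E_lt (fsubsetP tE _ it).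
exists i; split=> // [||j ji]; rewrite !in_fset1U ?it ?orbT //.
  by rewrite negb_or is_ andbT neq_ltn ltim.
by rewrite ij.
Qed.

Lemma slt_top t : t `<=` E -> slt t (m |` t).
Proof.
move=> tE; exists m; split=> [||j jm]; first exact: fset1U1.
  exact: contra (fsubsetP tE m) notin_ground.
by rewrite in_fset1U ltn_eqF.
Qed.

Lemma slt_U1_inv s t : s `<=` m |` E -> t `<=` E -> slt s (m |` t) ->
  s = t \/ slt (s `\ m) t.
Proof.
move=> sE tE [i [it is_ ij]].
move: it; rewrite in_fset1U => /orP[/eqP im|it]; [left|right].
  rewrite im in is_ ij; apply/fsetP => x; case: (ltngtP x m) => [xm|xm|->].
  - by rewrite ij // in_fset1U ltn_eqF.
  - have xE : x \notin E by apply/negP => /E_lt; rewrite ltnNge ltnW.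
    rewrite (negPf (contra (fsubsetP tE x) xE)).
    apply/negP => /(fsubsetP sE); rewrite in_fset1U (negPf xE) orbF gtn_eqF //.
  - rewrite (negPf is_); apply/esym/negP => /(fsubsetP tE).
    exact/negP/notin_ground.
have ltim := E_lt (fsubsetP tE _ it).
exists i; split=> // [|j ji]; first by rewrite in_fsetD1 negb_and is_ orbT.
have jm : (j == m) = false by rewrite ltn_eqF ?(ltn_trans ji).
by rewrite in_fsetD1 ij // in_fset1U jm.
Qed.

Lemma lower_span_ground t g B : lower_span E t g -> g (B `\ m) = g B.
Proof.
elim=> {g} [g g0|c s g g' sE st _ IHg gE]; first by rewrite !g0.
by rewrite !gE IHg fsubset_top.
Qed.

Lemma lower_span_mulX t g : t `<=` E -> lower_span E t g ->
  lower_span (m |` E) t (fun B => (m \in B)%:R * g B)%R.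
Proof.
move=> tE; elim=> {g} [g g0|c s g g' sE st _ IHg gE].
  by apply: lower_span0 => B; rewrite g0 mulr0.
have msE : m |` s `<=` m |` E by rewrite fsetUS.
apply: (lower_span_cons msE (slt_U1 tE st) IHg (c := c)) => B.
by rewrite gE mulrDr fsubsetU1_top; case: (m \in B); rewrite ?mul1r ?mul0r ?mulr0.
Qed.

Lemma lower_span_mulX_top t g : t `<=` E -> lower_span E t g ->
  lower_span (m |` E) (m |` t) (fun B => (m \in B)%:R * g B)%R.
Proof.
move=> tE; elim=> {g} [g g0|c s g g' sE st _ IHg gE].
  by apply: lower_span0 => B; rewrite g0 mulr0.
have msE : m |` s `<=` m |` E by rewrite fsetUS.
apply: (lower_span_cons msE (slt_U1l tE st) IHg (c := c)) => B.
by rewrite gE mulrDr fsubsetU1_top; case: (m \in B); rewrite ?mul1r ?mul0r ?mulr0.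
Qed.

Lemma lower_span_widen t t' g : (forall s, slt s t -> slt s t') ->
  lower_span E t g -> lower_span (m |` E) t' g.
Proof.
move=> tt'; elim=> {g} [g g0|c s g g' sE st _ IHg gE]; first exact: lower_span0.
have sE' : s `<=` m |` E by rewrite (fsubset_trans sE) ?fsubsetU1.
exact: (lower_span_cons sE' (tt' _ st) IHg gE).
Qed.

(** The substitution [x_m = 0]: terms containing [m] vanish, the others survive. *)
Lemma lower_span_del t g : t `<=` E -> lower_span (m |` E) t g ->
  lower_span E t (fun B => g (B `\ m)).
Proof.
move=> tE; elim=> {g} [g g0|c s g g' sE st _ IHg gE]; first exact: lower_span0.
have [ms|ms] := boolP (m \in s).
  apply: lower_span_eq IHg _ => B; rewrite gE.
  case: fsubsetP => [/(_ m ms)|_]; last by rewrite mulr0 add0r.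
  by rewrite in_fsetD1 eqxx.
have sE' : s `<=` E by rewrite -(mem_fsetD1 ms) fsubD1_ground.
by apply: (lower_span_cons sE' st IHg (c := c)) => B; rewrite gE fsubset_top.
Qed.

(** The substitution [x_m = 1]: [m] is dropped from every term, which stays below [t]. *)
Lemma lower_span_con t g : t `<=` E -> lower_span (m |` E) t g ->
  lower_span E t (fun B => g (m |` B)).
Proof.
move=> tE; elim=> {g} [g g0|c s g g' sE st _ IHg gE]; first exact: lower_span0.
apply: (lower_span_cons (fsubD1_ground sE) (slt_D1 tE st) IHg (c := c)) => B.
by rewrite gE fsubset_addtop.
Qed.

(** By [slt_U1_inv] the only term that can turn into [t] under [x_m = 0] or [x_m = 1] is [t] itself,
    so its coefficient [c] is common to both substitutions; all other terms stay below [t]. *)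
Lemma lower_span_top t g : t `<=` E -> lower_span (m |` E) (m |` t) g ->
  exists c g0 g1, [/\ lower_span E t g0, lower_span E t g1,
    forall B, (g (B `\ m) = c * (t `<=` B)%:R + g0 B)%R &
    forall B, (g (m |` B) = c * (t `<=` B)%:R + g1 B)%R].
Proof.
move=> tE; elim=> {g} [g g0|c s g g' sE st _ [c' [g0 [g1 [s0 s1 g0E g1E]]]] gE].
  exists 0%R, (fun=> 0%R), (fun=> 0%R).
  by split=> [||B|B]; rewrite ?g0 ?mul0r ?addr0 //; apply: lower_span0.
have [st'|st'] := slt_U1_inv sE tE st.
  exists (c + c')%R, g0, g1; split=> // B; rewrite gE st'.
    by rewrite g0E fsubset_top // mulrDl addrA.
  rewrite g1E fsubset_addtop mem_fsetD1 ?mulrDl ?addrA //.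
  exact: contra (fsubsetP tE m) notin_ground.
have sE' := fsubD1_ground sE.
have g1S : lower_span E t (fun B => c * (s `\ m `<=` B)%:R + g1 B)%R.
  exact: lower_span_cons sE' st' s1 _.
have g1E' B : (g' (m |` B) =
    c' * (t `<=` B)%:R + (c * (s `\ m `<=` B)%:R + g1 B))%R.
  by rewrite gE g1E fsubset_addtop addrCA.
have [ms|ms] := boolP (m \in s).
  exists c', g0, (fun B => c * (s `\ m `<=` B)%:R + g1 B)%R; split=> // B.
  rewrite gE g0E; case: fsubsetP => [/(_ m ms)|_]; last by rewrite mulr0 add0r.
  by rewrite in_fsetD1 eqxx.
exists c', (fun B => c * (s `\ m `<=` B)%:R + g0 B)%R,
  (fun B => c * (s `\ m `<=` B)%:R + g1 B)%R; split=> // [|B].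
  exact: lower_span_cons sE' st' s0 _.
have sE2 : s `<=` E by rewrite -(mem_fsetD1 ms).
by rewrite gE g0E (mem_fsetD1 ms) (fsubset_top _ sE2) addrCA.
Qed.

Variable V : {fset nat} -> Prop.
Let V0 B := m \notin B /\ V B.
Let V1 B := m \notin B /\ V (m |` B).

Lemma nonstandard_notin t : t `<=` E ->
  nonstandard (m |` E) V t <-> nonstandard E V0 t /\ nonstandard E V1 t.
Proof.
move=> tE; split=> [[g sg gV]|[[g0 s0 g0V] [g1 s1 g1V]]].
  split.
    exists (fun B => g (B `\ m)); first exact: lower_span_del.
    by move=> B [mB VB]; rewrite mem_fsetD1 // gV.
  exists (fun B => g (m |` B)); first exact: lower_span_con.
  move=> B [mB VB]; rewrite -gV // fsubset_addtop mem_fsetD1 //.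
  exact: contra (fsubsetP tE m) notin_ground.
(* Linear interpolation in [x_m]: [g0 + x_m (g1 - g0)]. *)
exists (fun B => g0 B + ((m \in B)%:R * g1 B + -1 * ((m \in B)%:R * g0 B)))%R.
  apply: lower_spanD; first exact: lower_span_widen s0.
  apply: lower_spanD; first exact: lower_span_mulX.
  by apply: lower_spanZ; apply: lower_span_mulX.
move=> B VB; have [mB|mB] := boolP (m \in B).
  rewrite -(lower_span_ground B s1) -g1V ?fsubset_top //.
    by rewrite !mul1r; ring.
  by split; rewrite ?fsetD11 ?fsetD1K // in_fsetD1 eqxx.
by rewrite !mul0r mulr0 !addr0 -g0V.
Qed.

Lemma nonstandard_in t : t `<=` E ->
  nonstandard (m |` E) V (m |` t) <-> nonstandard E V0 t \/ nonstandard E V1 t.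
Proof.
move=> tE; split=> [[g sg gV]|[[g0 s0 g0V]|[g1 s1 g1V]]].
- have [c [g0 [g1 [s0 s1 g0E g1E]]]] := lower_span_top tE sg.
  have [c0|c_neq0] := eqVneq c 0%R; [right|left].
    exists g1 => // B [mB VB]; have := gV _ VB.
    by rewrite g1E c0 mul0r add0r fsubsetU1_top fset1U1 fsubset_addtop
      mem_fsetD1 // (contra (fsubsetP tE m) notin_ground).
  (* At points without [m] the monomial [x_m t] vanishes, so [c t + g0 = 0] there and [c] can be
     divided out. *)
  exists (fun B => - c^-1 * g0 B)%R; first exact: lower_spanZ.
  move=> B [mB VB]; have := gV _ VB; rewrite -{2}(mem_fsetD1 mB) g0E.
  rewrite fsubsetU1_top (negPf mB) => /esym/eqP.
  by rewrite addr_eq0 => /eqP cE; rewrite mulNr -mulrN -cE mulKf.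
(* The function [t + (x_m - 1) g0], where [t] itself is allowed because it lies below [x_m t]. *)
- exists (fun B => (t `<=` B)%:R + ((m \in B)%:R * g0 B + -1 * g0 B))%R.
    apply: lower_spanD.
      by apply: lower_span1; [exact: fsubset_trans tE (fsubsetU1 _ _)|exact: slt_top].
    apply: lower_spanD; first exact: lower_span_mulX_top.
    by apply: lower_spanZ; apply: lower_span_widen s0 => s; apply: slt_U1r.
  move=> B VB; rewrite fsubsetU1_top; have [mB|mB] := boolP (m \in B) => /=.
    by rewrite mul1r; ring.
  by rewrite (g0V B) // mul0r; ring.
- exists (fun B => (m \in B)%:R * g1 B)%R; first exact: lower_span_mulX_top.
  move=> B VB; rewrite fsubsetU1_top.
  have [mB|mB] := boolP (m \in B); last by rewrite mul0r.
  rewrite mul1r -(lower_span_ground B s1) -g1V ?fsubset_top //.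
  by split; rewrite ?fsetD1K // in_fsetD1 eqxx.
Qed.

End Nonstandard.

(** * Membership in the initial ideal as nonstandardness *)

Section Initial.
Variable E : {fset nat}.
Implicit Types (i j : 'I_(gk E)) (k : 'X_{1..gk E}) (s t B : {fset nat}).

Lemma gelt_in i : gelt i \in E.
Proof. by rewrite -(mem_sort leq) mem_nth. Qed.

Lemma gelt_surj x : x \in E -> exists i, gelt i = x.
Proof.
rewrite -(mem_sort leq) => xE.
have xlt : index x (gsort E) < gk E by rewrite index_mem.
by exists (Ordinal xlt); rewrite /gelt nth_index.
Qed.

Lemma gelt_lt i j : i < j -> gelt i < gelt j.
Proof.
move=> ij; apply: (sorted_ltn_nth ltn_trans) => //; rewrite ?inE //.
rewrite ltn_sorted_uniq_leq sort_uniq fset_uniq /=.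
exact: (sort_sorted leq_total).
Qed.

Lemma gelt_inj : injective (@gelt E).
Proof.
move=> i j eij; apply/val_inj; case: (ltngtP i j) => // /gelt_lt;
  by rewrite eij ltnn.
Qed.

Lemma gelt_ltE i j : (gelt i < gelt j) = (i < j).
Proof.
by case: (ltngtP i j) => [/gelt_lt//|/gelt_lt/ltnW|/val_inj->];
  rewrite ?ltnn // leqNgt => /negPf.
Qed.

Definition msupport k : {fset nat} := [fset gelt i | i : 'I_(gk E) & 0 < k i].

Lemma in_msupport k i : (gelt i \in msupport k) = (0 < k i).
Proof.
apply/imfsetP/idP => [[j /= + /gelt_inj->] //|ki].
by exists i.
Qed.

Lemma msupport_sub k : msupport k `<=` E.
Proof. by apply/fsubsetP => x /imfsetP[i _ ->]; apply: gelt_in. Qed.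

Lemma sqmonoE t i : sqmono E t i = (gelt i \in t).
Proof. by rewrite mnmE. Qed.

Lemma msupport_sqmono t : t `<=` E -> msupport (sqmono E t) = t.
Proof.
move=> tE; apply/fsetP => x; have [/gelt_surj[i <-]|xE] := boolP (x \in E).
  by rewrite in_msupport sqmonoE lt0b.
rewrite (negPf (contra (fsubsetP tE x) xE)).
by apply/negbTE; apply: contra xE; apply: (fsubsetP (msupport_sub _)).
Qed.

Lemma evec_monomial B k :
  (\prod_i @evec E B i ^+ k i = (msupport k `<=` B)%:R)%R.
Proof.
have [/fsubsetP kB|/fsubsetPn[x /imfsetP[i /= ki ->] xB]] := boolP (_ `<=` _).
  rewrite big1 // => i _; have [->//|ki] := posnP (k i).
  by rewrite /evec kB ?in_msupport // expr1n.
by rewrite (bigD1 i) //= /evec (negPf xB) expr0n (gtn_eqF ki) mul0r.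
Qed.

(** Since [t] is squarefree, the exponent of [k] at the first difference is 0, and the earlier
    exponents agree with those of [t]; passing to supports therefore keeps the strict inequality. *)
Lemma lexlt_slt k t : t `<=` E -> lexlt k (sqmono E t) -> slt (msupport k) t.
Proof.
move=> tE [i [kj ki]]; rewrite sqmonoE in ki; exists (gelt i); split.
- by case: (_ \in t) ki.
- by rewrite in_msupport; case: (_ \in t) ki; case: (k i).
move=> x xi; have [/gelt_surj[j jx]|xE] := boolP (x \in E).
  by rewrite -jx gelt_ltE in xi *; rewrite in_msupport kj // sqmonoE lt0b.
rewrite (negPf (contra (fsubsetP tE x) xE)).
by apply/negbTE; apply: contra xE; apply: (fsubsetP (msupport_sub _)).
Qed.

Lemma slt_lexlt s t : t `<=` E -> slt s t -> lexlt (sqmono E s) (sqmono E t).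
Proof.
move=> tE [x [xt xs xj]]; have [i ix] := gelt_surj (fsubsetP tE x xt).
exists i; split=> [j ji|]; rewrite !sqmonoE ?ix ?xt ?(negPf xs) //.
by rewrite xj // -ix gelt_ltE.
Qed.

Lemma lower_span_poly t (g : {fset nat} -> RR) : t `<=` E -> lower_span E t g ->
  exists p : {mpoly RR[gk E]}, (forall B, p.@[@evec E B] = g B)%R /\
    forall k, k \in msupp p -> lexlt k (sqmono E t).
Proof.
move=> tE; elim=> {g} [g g0|c s g g' sE st _ [p [pg pt]] gE].
  by exists 0%R; split=> [B|k]; rewrite ?meval0 ?g0 // msupp0.
exists (c *: 'X_[sqmono E s] + p)%R; split=> [B|k].
  by rewrite mevalD mevalZ mevalX evec_monomial msupport_sqmono // pg gE.
move/msuppD_le; rewrite mem_cat => /orP[/msuppZ_le|/pt //].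
by rewrite msuppX inE => /eqP->; apply: slt_lexlt.
Qed.

Lemma lower_span_sum (I : eqType) (r : seq I) (P : pred I) t
    (g : I -> {fset nat} -> RR) :
  (forall x, x \in r -> P x -> lower_span E t (g x)) ->
  lower_span E t (fun B => \sum_(x <- r | P x) g x B)%R.
Proof.
elim: r => [|a r IHr] gr; first by apply: lower_span0 => B; rewrite big_nil.
have sr : lower_span E t (fun B => \sum_(x <- r | P x) g x B)%R.
  by apply: IHr => x xr; apply: gr; rewrite inE xr orbT.
have [Pa|Pa] := boolP (P a).
  have sa := gr a (mem_head _ _) Pa.
  by apply: lower_span_eq (lower_spanD sa sr) _ => B; rewrite big_cons Pa.
by apply: lower_span_eq sr _ => B; rewrite big_cons (negPf Pa).
Qed.

(** A monomial of the initial ideal is a multiple of some leading monomial; on 0/1-points the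
    corresponding multiple of the polynomial rewrites it by smaller squarefree monomials. Conversely
    such a rewriting is a vanishing polynomial with leading monomial [t]. *)
Lemma in_initial_nonstandard (Bs : {fset {fset nat}}) t : t `<=` E ->
  in_initial Bs 'X_[sqmono E t] <-> nonstandard RR E (fun B => B \in Bs) t.
Proof.
move=> tE; split=> [[r [rP Xr]]|[g sg gB]]; last first.
  have [p [pg pt]] := lower_span_poly tE sg.
  have p_t : (p@_(sqmono E t) = 0)%R.
    apply/eqP; rewrite mcoeff_eq0; apply/negP => /pt[i [_]]; by rewrite ltnn.
  exists [:: (1, 'X_[sqmono E t] - p, sqmono E t)]%R; split; last first.
    by rewrite big_seq1 mul1r.
  move=> _ /[!inE]/eqP-> /=; split=> [B /gB BsB|].
    by rewrite mevalB mevalX evec_monomial msupport_sqmono // pg BsB subrr.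
  split=> [|k /msuppB_le].
    by rewrite mcoeff_msupp mcoeffB mcoeffX eqxx p_t subr0 oner_eq0.
  by rewrite mem_cat msuppX inE => /orP[->|/pt].
have Xr0 : (('X_[sqmono E t] : {mpoly RR[gk E]})@_(sqmono E t) != 0)%R.
  by rewrite mcoeffX eqxx oner_neq0.
(* A summand with a nonzero coefficient at the monomial of [t] has its leading monomial dividing
   it. *)
have [u ur Xu] : exists2 u, u \in r & ((u.1.1 * 'X_[u.2])@_(sqmono E t) != 0)%R.
  apply/hasP; apply: contraTT Xr0 => /hasPn r0.
  rewrite Xr raddf_sum big_seq big1 ?eqxx // => u /r0.
  by rewrite negbK => /eqP.
case: u ur Xu => [[a f] k] /= /rP[/= fV [kf fk]] aX.
have [k' tk] : exists k', sqmono E t = (k + k')%MM.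
  have := aX; rewrite -mcoeff_msupp (perm_mem (msuppMX _ _)).
  by case/mapP => k' _ ->; exists k'.
have fk0 : (f@_k != 0)%R by rewrite -mcoeff_msupp.
(* Multiply [f] by the cofactor [k'], divide by the leading coefficient and solve for the leading
   term. *)
exists (fun B => \sum_(l <- msupp f | l != k)
    (- (f@_k)^-1 * f@_l) * (msupport (l + k')%MM `<=` B)%:R)%R.
  apply: lower_span_sum => l lf lk; apply/lower_spanZ/lower_span1.
    exact: msupport_sub.
  have [i [ij ii]] := fk l lf lk.
  apply: lexlt_slt => //; rewrite tk; exists i; split=> [j ji|]; rewrite !mnmDE.
    by rewrite ij.
  by rewrite ltn_add2r.
move=> B /fV; rewrite mevalE => /(congr1 (fun x => x * (msupport k' `<=` B)%:R)%R).
have mM (l : 'X_{1..gk E}) : (\prod_i @evec E B i ^+ l i * (msupport k' `<=` B)%:R =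
    (msupport (l + k')%MM `<=` B)%:R)%R.
  rewrite -!evec_monomial -big_split; apply: eq_bigr => i _.
  by rewrite mnmDE exprD.
rewrite mul0r mulr_suml (bigD1_seq k) //= -mulrA mM -tk msupport_sqmono //.
move/eqP; rewrite addr_eq0 => /eqP ft.
apply: (mulfI fk0); rewrite ft mulr_sumr -sumrN; apply: eq_bigr => l _.
by rewrite -mulrA mM !mulrA mulrN mulfV // mulN1r mulNr.
Qed.

End Initial.

Lemma in_ground n x : (x \in ground n) = (0 < x <= n).
Proof.
apply/imfsetP/idP => [[j /= + ->]|/andP[x0 xn]]; first by rewrite mem_iota.
by exists x.-1; rewrite /= ?prednK // mem_iota; lia.
Qed.

Lemma groundS n : ground n.+1 = n.+1 |` ground n.
Proof. by apply/fsetP => x; rewrite in_fset1U !in_ground; lia. Qed.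

Lemma ground_lt n x : x \in ground n -> x < n.+1.
Proof. by rewrite in_ground => /andP[]. Qed.

Lemma ground_last n : n.+1 \notin ground n.
Proof. by rewrite in_ground ltnn andbF. Qed.

Lemma max_ground n : \max_(e <- ground n.+1) e = n.+1.
Proof.
apply/eqP; rewrite eqn_leq; apply/andP; split.
  by apply/bigmax_leqP_seq => x; rewrite in_ground => /andP[].
by apply: (@leq_bigmax_seq _ (enum_fset (ground n.+1)) xpredT id n.+1);
  rewrite // in_ground ltnSn.
Qed.

Lemma nonstandard_ext (F : fieldType) E (V V' : {fset nat} -> Prop) t :
  (forall B, V B <-> V' B) -> nonstandard F E V t <-> nonstandard F E V' t.
Proof. by move=> VV; split=> -[g sg gV]; exists g => // B /VV/gV. Qed.

(** * Path matroids *)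

Section PathMatroid.
Variables (lo hi : nat -> nat) (d : nat).
Hypothesis hi_mono : forall k, hi k <= hi k.+1.
Implicit Types (n b : nat) (c : bool) (w : seq bool) (t B : {fset nat}).

(* [b] counts the east steps still to come: deletion and contraction of the last
   element lead to [words n b] and [words n b.+1]. *)
Definition words (n b : nat) : seq (seq bool) :=
  [seq w <- [seq val w | w : n.-tuple bool] |
    admissible lo hi w && (count id w + b == d)%N].

Definition bases n b : {fset {fset nat}} := [fset easts w | w in words n b].

Definition markings n b : {fset {fset nat}} := [fset unmarked hi w | w in words n b].

Lemma mem_words n b w :
  (w \in words n b) = [&& size w == n, admissible lo hi w & (count id w + b == d)%N].
Proof.
rewrite mem_filter andbC; congr (_ && _).
apply/imageP/eqP => [[u _ ->]|sw]; first exact: size_tuple.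
by exists (tcast sw (in_tuple w)); rewrite //= val_tcast.
Qed.

Lemma words_cons n b c w : c :: w \in words n.+1 b ->
  w \in words n (c + b)%N.
Proof.
by rewrite !mem_words /= eqSS -addnA addnCA => /and3P[-> /andP[-> _] ->].
Qed.

(** The bounds at the last position concern only the number of east steps, which is the same for all
    of [words n.+1 b]; one word [w0] certifies them for every other. *)
Lemma cons_words n b c w w0 : w0 \in words n.+1 b ->
  w \in words n (c + b)%N ->
  c :: w \in words n.+1 b.
Proof.
rewrite !mem_words; case: w0 => [|c0 w0] //= /and3P[/eqP[<-] /andP[_ g0] /eqP e0].
case/and3P=> /eqP sw -> /eqP e; rewrite sw eqxx /=.
suff -> : (c + count id w = c0 + count id w0)%N by rewrite g0 /= e0.
by clear -e0 e; lia.
Qed.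

Lemma words_size n b w : w \in words n b -> size w = n.
Proof. by rewrite mem_words => /and3P[/eqP]. Qed.

Lemma basesP n b B :
  reflect (exists2 w, w \in words n b & B = easts w) (B \in bases n b).
Proof. exact: imfsetP. Qed.

Lemma markingsP n b t :
  reflect (exists2 w, w \in words n b & t = unmarked hi w) (t \in markings n b).
Proof. exact: imfsetP. Qed.

Lemma easts_ground n b w : w \in words n b -> easts w `<=` ground n.
Proof.
by move=> /words_size <-; apply/fsubsetP => x /easts_le; rewrite in_ground.
Qed.

Lemma unmarked_ground n b w : w \in words n b -> unmarked hi w `<=` ground n.
Proof.
by move=> /words_size <-; apply/fsubsetP => x /unmarked_le; rewrite in_ground.
Qed.

Lemma bases_del n b w0 B : w0 \in words n.+1 b ->
  (n.+1 \notin B) && (B \in bases n.+1 b) = (B \in bases n b).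
Proof.
move=> w0P; apply/andP/basesP => [[nB /basesP[[|c w] wP BE]]|[w wP ->]].
- by have := words_size wP.
- have [sw] := words_size wP; have wP' := words_cons wP.
  by case: c BE wP' {wP} => BE wP'; [rewrite BE /= sw fset1U1 in nB | exists w].
- split; first by rewrite -(words_size wP) easts_last.
  by apply/basesP; exists (false :: w) => //; apply: cons_words w0P _.
Qed.

Lemma bases_con n b w0 B : w0 \in words n.+1 b ->
  (n.+1 \notin B) && (n.+1 |` B \in bases n.+1 b) = (B \in bases n b.+1).
Proof.
move=> w0P; apply/andP/basesP => [[nB /basesP[[|c w] wP BE]]|[w wP ->]].
- by have := words_size wP.
- have [sw] := words_size wP; have wP' := words_cons wP.
  case: c BE wP' {wP} => BE wP'; last first.
    by have := fset1U1 n.+1 B; rewrite BE /= -sw easts_last.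
  exists w => //; rewrite -(fsetU1K nB) BE /= sw fsetU1K //.
  by rewrite -sw easts_last.
- split; first by rewrite -(words_size wP) easts_last.
  apply/basesP; exists (true :: w); last by rewrite /= (words_size wP).
  exact: cons_words w0P _.
Qed.

Lemma markings_add n b w : w \in words n b.+1 -> 0 < pending hi w ->
  unmarked hi w \in markings n b.
Proof.
rewrite mem_words => /and3P[/eqP sw aw /eqP cw] p0.
have [w' [sw' aw' cw' uw' _]] := unmarked_add_east hi_mono aw p0.
apply/markingsP; exists w' => //.
by rewrite mem_words sw' sw eqxx aw' cw' addSnnS cw eqxx.
Qed.

(** A word in [words n b] has one more east step than [w], so [pending_antitone] applies with a gap
    of one. *)
Lemma markings_pending n b w : w \in words n b.+1 ->
  unmarked hi w \in markings n b -> 0 < pending hi w.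
Proof.
move=> + /markingsP[w1]; rewrite !mem_words.
move=> /and3P[/eqP s2 a2 /eqP c2] /and3P[/eqP s1 a1 /eqP c1] uE.
have le21 : count id w <= count id w1 by clear -c1 c2; lia.
have sz : size w = size w1 by rewrite s1.
have := pending_antitone hi_mono sz a2 a1 uE le21.
by clear -c1 c2; lia.
Qed.

(** A marking from [b.+1] extends by a marked east step if nothing is pending; otherwise
    [markings_add] moves it to [b], where a north step extends it. *)
Lemma markings_notin n b w0 t : w0 \in words n.+1 b -> n.+1 \notin t ->
  (t \in markings n.+1 b) = (t \in markings n b) || (t \in markings n b.+1).
Proof.
move=> w0P nt; apply/markingsP/orP => [[[|c w] wP tE]|].
- by have := words_size wP.
- have [sw] := words_size wP; have wP' := words_cons wP.
  case: c tE wP' {wP} => tE wP'; [right|left]; apply/markingsP; exists w => //.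
  move: tE; rewrite /=; case: ifP => // _ tE.
  by rewrite tE sw fset1U1 in nt.
- case=> /markingsP[w wP ->].
    by exists (false :: w) => //; apply: cons_words w0P _.
  have [p0|p_gt0] := posnP (pending hi w).
    exists (true :: w); last by rewrite /= p0.
    exact: cons_words w0P _.
  have /markingsP[w' w'P ->] := markings_add wP p_gt0.
  by exists (false :: w') => //; apply: cons_words w0P _.
Qed.

(** The last east step is unmarked exactly when a column is pending, which by [markings_add] and
    [markings_pending] means that the marking of the prefix also occurs for [b]. *)
Lemma markings_in n b w0 t : w0 \in words n.+1 b -> n.+1 \notin t ->
  (n.+1 |` t \in markings n.+1 b) = (t \in markings n b) && (t \in markings n b.+1).
Proof.
move=> w0P nt; apply/markingsP/andP => [[[|c w] wP tE]|].
- by have := words_size wP.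
- have [sw] := words_size wP; have wP' := words_cons wP.
  have ntE := fset1U1 n.+1 t; rewrite tE in_unmarked sw eqxx andbT in ntE.
  have nw : n.+1 \notin unmarked hi w by rewrite -sw unmarked_last.
  move: ntE; rewrite (negPf nw) orbF => /andP[cT p_gt0].
  rewrite cT in tE wP'; rewrite /= p_gt0 sw in tE.
  have -> : t = unmarked hi w by rewrite -(fsetU1K nt) tE fsetU1K.
  by split; [exact: markings_add | apply/markingsP; exists w].
- case=> /markingsP[w1 w1P tE1] /markingsP[w2 w2P tE2].
  have p_gt0 : 0 < pending hi w2.
    by apply: (markings_pending w2P); rewrite -tE2 tE1; apply/markingsP; exists w1.
  exists (true :: w2); last by rewrite /= p_gt0 (words_size w2P) -tE2.
  exact: cons_words w0P _.
Qed.

Lemma lower_span_fset0 (F : fieldType) E (g : {fset nat} -> F) :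
  lower_span E fset0 g -> forall B, g B = 0%R.
Proof. by case=> // c s g1 g' _ [i []]; rewrite inE. Qed.

(** Deletion keeps [b] and contraction raises it, and both sides obey the same recursion; hence the
    induction on [n] for all [b]. *)
Lemma nonstandard_bases (F : fieldType) n b t : t `<=` ground n ->
  nonstandard F (ground n) (fun B => B \in bases n b) t <-> t \notin markings n b.
Proof.
elim: n b t => [|n IHn] b t tn.
  have t0 : t = fset0.
    apply/fsetP => x; rewrite inE; apply/negP => /(fsubsetP tn).
    by rewrite in_ground; case: x.
  split=> [[g]|tN].
    rewrite t0 => /lower_span_fset0 g0 gB; apply/markingsP => -[w wP _].
    have := gB (easts w); rewrite fsub0set g0 => /(_ _)/eqP.
    by rewrite oner_eq0 => H; apply/notF/H/basesP; exists w.
  exists (fun=> 0%R); first exact: lower_span0.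
  move=> B /basesP[w wP _]; case/markingsP: tN; exists w => //.
  by rewrite t0 (size0nil (words_size wP)).
(* Without words there are no points and no markings, and every set is nonstandard; otherwise [w0]
   starts the recursions. *)
have [/hasP[w0 w0P _]|/hasPn wN] := boolP (has xpredT (words n.+1 b)); last first.
  split=> _; first by apply/markingsP => -[w /wN].
  exists (fun=> 0%R); first exact: lower_span0.
  by move=> B /basesP[w /wN].
set V := fun B => B \in bases n.+1 b.
have V0E B : (n.+1 \notin B /\ V B) <-> B \in bases n b.
  by rewrite -(bases_del B w0P) /V; split=> [[-> ->]|/andP].
have V1E B : (n.+1 \notin B /\ V (n.+1 |` B)) <-> B \in bases n b.+1.
  by rewrite -(bases_con B w0P) /V; split=> [[-> ->]|/andP].
have t'n : t `\ n.+1 `<=` ground n by rewrite fsubDset -groundS.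
have nt' : n.+1 \notin t `\ n.+1 by rewrite in_fsetD1 eqxx.
have N0 := iff_trans (nonstandard_ext F (ground n) _ V0E) (IHn b _ t'n).
have N1 := iff_trans (nonstandard_ext F (ground n) _ V1E) (IHn b.+1 _ t'n).
rewrite groundS; have [nt|nt] := boolP (n.+1 \in t).
  have := nonstandard_in F (@ground_lt n) V t'n; rewrite fsetD1K // => ->.
  rewrite -[t in t \notin _](fsetD1K nt) (markings_in w0P nt') negb_and.
  by rewrite N0 N1; split=> /orP.
rewrite (mem_fsetD1 nt) in t'n N0 N1.
rewrite (nonstandard_notin F (@ground_lt n) V t'n) N0 N1.
by rewrite (markings_notin w0P nt) negb_or; split=> /andP.
Qed.

(** The word [w0] settles [n = 0], where [Slex] contains the empty set by convention. *)
Lemma Slex_bases n b w0 t : w0 \in words n b ->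
  Slex (ground n) (bases n b) t <-> t \in markings n b.
Proof.
move=> w0P; rewrite /Slex.
case: n w0P => [|n] w0P.
  have -> : ground 0 == fset0.
    by apply/eqP/fsetP => x; rewrite in_ground inE; case: x.
  split=> [->|/markingsP[w wP ->]]; last by rewrite (size0nil (words_size wP)).
  by apply/markingsP; exists w0; rewrite // (size0nil (words_size w0P)).
have -> : (ground n.+1 == fset0) = false.
  by apply/eqP => /fsetP/(_ n.+1); rewrite in_ground ltnSn inE.
split=> [[tn]|tM].
  rewrite in_initial_nonstandard // nonstandard_bases // => /negP.
  by rewrite negbK.
have tn : t `<=` ground n.+1 by case/markingsP: tM => w /unmarked_ground ? ->.
split=> //; rewrite in_initial_nonstandard // nonstandard_bases //.
by rewrite tM.
Qed.

Lemma is_matroid_bases n b w0 : w0 \in words n b ->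
  is_matroid (ground n) (bases n b).
Proof.
move=> w0P; split.
- by apply/fset0Pn; exists (easts w0); apply/basesP; exists w0.
- by move=> B /basesP[w wP ->]; apply: easts_ground wP.
move=> _ _ /basesP[w1 w1P ->] /basesP[w2 w2P ->] x x12.
move: (w1P) (w2P); rewrite !mem_words.
move=> /and3P[/eqP s1 a1 /eqP c1] /and3P[/eqP s2 a2 /eqP c2].
have sz : size w1 = size w2 by rewrite s1.
(* Equal numbers of east steps exclude the alternative of a mere removal. *)
have [[y [w [yE sw aw cw ew]]]|[c12 _]] := easts_exchange sz a1 a2 x12; last first.
  by exfalso; clear -c1 c2 c12; lia.
exists y => //; apply/basesP; exists w; last by rewrite ew fsetUC.
by rewrite mem_words sw s1 eqxx aw cw c1 eqxx.
Qed.

(** The word ending in a north step shows that [n.+1] is not a coloop, which selects the first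
    branch of [del_bases]. *)
Lemma del_bases_words n b w : false :: w \in words n.+1 b ->
  del_bases (bases n.+1 b) n.+1 = bases n b.
Proof.
move=> wP; rewrite /del_bases ifT; last first.
  apply/(@hasP _ (fun B : {fset nat} => n.+1 \notin B)).
  exists (easts (false :: w)); first by apply/basesP; exists (false :: w).
  by have [<-] := words_size wP; rewrite easts_last.
apply/fsetP => B; rewrite -(bases_del B wP).
apply/imfsetP/andP => [[B' /= /andP[B'P nB'] ->] //|[nB BP]].
by exists B => //=; apply/andP.
Qed.

Lemma con_bases_words n b w : true :: w \in words n.+1 b ->
  con_bases (bases n.+1 b) n.+1 = bases n b.+1.
Proof.
move=> wP; rewrite /con_bases ifT; last first.
  apply/(@hasP _ (fun B : {fset nat} => n.+1 \in B)).
  exists (easts (true :: w)); first by apply/basesP; exists (true :: w).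
  by have [<-] := words_size wP; rewrite fset1U1.
apply/fsetP => B; rewrite -(bases_con B wP).
apply/imfsetP/andP => [[B' /= /andP[B'P nB'] ->]|[nB BP]].
  by rewrite fsetD1K // in_fsetD1 eqxx.
by exists (n.+1 |` B); rewrite ?fsetU1K //=; apply/andP; rewrite fset1U1.
Qed.

(** The recursion fixes the value up to the membership of [n.+1] when the last step is east;
    surjectivity-type information from [Slex_bases] and injectivity of [Lam] decide it. *)
Lemma Lambda_bases Lam n b w : is_Lambda_family Lam -> w \in words n b ->
  Lam (ground n) (bases n b) (easts w) = unmarked hi w.
Proof.
move=> LamP; elim: n b w => [|n IHn] b w wP.
  have [LamS _ _ _] := LamP _ _ (is_matroid_bases wP).
  have /LamS/(Slex_bases _ wP)/markingsP[w' w'P ->] : easts w \in bases 0 b.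
    by apply/basesP; exists w.
  by rewrite (size0nil (words_size wP)) (size0nil (words_size w'P)).
have [LamS Lam_inj _ Lam_rec] := LamP _ _ (is_matroid_bases wP).
have easts_bases u : u \in words n.+1 b -> easts u \in bases n.+1 b.
  by move=> uP; apply/basesP; exists u.
have gN0 : ground n.+1 != fset0.
  by apply/fset0Pn; exists n.+1; rewrite in_ground ltnSn.
have := Lam_rec gN0.
rewrite /= max_ground (_ : ground n.+1 `\ n.+1 = ground n); last first.
  by rewrite groundS fsetU1K ?ground_last.
move=> {}Lam_rec.
have nE u : size u = n -> n.+1 \notin easts u by move=> <-; rewrite easts_last.
have Lam_del u : false :: u \in words n.+1 b ->
    Lam (ground n.+1) (bases n.+1 b) (easts (false :: u)) = unmarked hi u.
  move=> uP; have [_ + _] := Lam_rec _ (easts_bases _ uP).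
have [su] := words_size uP; move/(_ (nE u su)) => ->.
  by rewrite (del_bases_words uP); apply: (IHn b u (words_cons uP)).
have := words_size wP; case: w wP => [//|[] w] wP [sw]; last exact: Lam_del.
have wP' := words_cons wP; have wB := easts_bases _ wP.
have [_ _] := Lam_rec _ wB.
have := LamS _ wB; rewrite (Slex_bases _ wP).
set T := Lam _ _ _ => TM; rewrite /= sw fset1U1 fsetU1K ?nE // => /(_ isT).
rewrite (con_bases_words wP) IHn // => TE.
(* If [n.+1] is in [T], then [T] being a marking forces a pending column. *)
have [nT|nT] := boolP (n.+1 \in T).
  have wM : unmarked hi w \in markings n b.
    move: TM; rewrite -(fsetD1K nT) TE (markings_in wP) => [/andP[] //|].
    by rewrite -sw unmarked_last.
  by rewrite (markings_pending wP' wM) -(fsetD1K nT) TE.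
rewrite (mem_fsetD1 nT) in TE.
(* If a column were pending but [n.+1] not in [T], a word [u] followed by a north step would have
   the same value [T], against injectivity. *)
case: ifP => // /(markings_add wP')/markingsP[u uP uE].
have uP' : false :: u \in words n.+1 b by apply: cons_words wP _.
have : easts (true :: w) = easts (false :: u).
  by apply: Lam_inj; rewrite ?easts_bases // Lam_del // -uE.
move=> /fsetP/(_ n.+1); rewrite /= sw fset1U1.
by rewrite (negPf (nE u (words_size uP))).
Qed.

End PathMatroid.

(** * The marking path *)

Lemma in_steps n (P : pred nat) x :
  (x \in [fset j.+1 | j in iota 0 n & P j]) = (0 < x <= n) && P x.-1.
Proof.
apply/imfsetP/andP => [[j /andP[jn Pj] ->]|[/andP[x0 xn] Px]].
  by have : j \in iota 0 n := jn; rewrite mem_iota.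
exists x.-1; last by rewrite prednK.
by apply/andP; split=> //; change (x.-1 \in iota 0 n); rewrite mem_iota add0n prednK.
Qed.

(** * Prefix counts and positions of east steps *)

Section Steps.
Variable W : seq bool.

Lemma neastS k : k < size W -> neast W k.+1 = nth false W k + neast W k.
Proof.
by move=> kW; rewrite /neast (take_nth false) // -cats1 count_cat addnC /= addn0.
Qed.

Lemma nnorthS k : k < size W -> nnorth W k.+1 = ~~ nth false W k + nnorth W k.
Proof.
by move=> kW; rewrite /nnorth (take_nth false) // -cats1 count_cat addnC /= addn0.
Qed.

Lemma nnorth_mono k l : k <= l -> nnorth W k <= nnorth W l.
Proof.
by move=> kl; rewrite /nnorth -(subnKC kl) takeD count_cat leq_addr.
Qed.

Lemma neast_mono k l : k <= l -> neast W k <= neast W l.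
Proof.
by move=> kl; rewrite /neast -(subnKC kl) takeD count_cat leq_addr.
Qed.

Lemma neast_count k : neast W k <= count id W.
Proof. by rewrite -[W in X in _ <= X](cat_take_drop k) count_cat leq_addr. Qed.

Lemma nnorth_count k : nnorth W k <= size W - count id W.
Proof.
rewrite -(count_predC id W) addKn -[W in X in _ <= X](cat_take_drop k) count_cat.
exact: leq_addr.
Qed.

Lemma epos_bound k x : k <= size W -> x < neast W k -> epos W x < k.
Proof.
elim: k => [|k IHk] kW; first by rewrite /neast take0.
have [/(IHk (ltnW kW))/ltnW //|xk] := ltnP x (neast W k).
rewrite neastS // => xk'; rewrite ltnS leqNgt; apply/negP => kp.
have := before_find 0 kp; rewrite nth_iota // add0n neastS // => /negP; apply.
by clear -xk xk'; case: (nth _ _ _) xk' => /=; lia.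
Qed.

Lemma epos_size x : x < count id W -> epos W x < size W.
Proof. by move=> xW; apply: epos_bound; rewrite // /neast take_size. Qed.

Lemma neast_epos x : x < count id W -> neast W (epos W x).+1 = x.+1.
Proof.
move=> /epos_size pW; have := pW; rewrite -[X in _ < X](size_iota 0) -has_find.
move=> /(nth_find 0); rewrite -/(epos W x) nth_iota // => /eqP.
by rewrite add0n.
Qed.

(** A Galois connection: [epos W x] is the 0-based index of the east step number [x.+1]. The
    comparisons of heights below go through it. *)
Lemma ltn_epos k x : k <= size W -> x < count id W ->
  (epos W x < k) = (x < neast W k).
Proof.
move=> kW xW; apply/idP/idP; last exact: epos_bound.
by move=> /neast_mono; rewrite neast_epos.
Qed.

Lemma neast_eposE x : x < count id W -> neast W (epos W x) = x.
Proof.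
move=> xW; have pW := epos_size xW; have := ltn_epos (ltnW pW) xW.
have := neast_epos xW; rewrite ltnn neastS //.
by clear; case: nth => /=; lia.
Qed.

Lemma epos_neast j : j < size W -> nth false W j -> epos W (neast W j) = j.
Proof.
move=> jW Wj; have xW : neast W j < count id W.
  by have := neast_count j.+1; rewrite neastS // Wj.
apply/eqP; rewrite eqn_leq -ltnS ltn_epos // neastS // Wj ltnSn /=.
by rewrite leqNgt ltn_epos ?ltnn // ltnW.
Qed.

End Steps.

(** * The greedy path column by column *)

Section Columns.
Variables hc hd : nat -> nat.

(** Height at which the marking path first meets the vertical line [x]. The previous line is left
    one step higher by a diagonal, or at constant height by an east step when [hc x'] is already
    attained; the minimum covers both. *)
Fixpoint enter (x : nat) : nat :=
  if x is x'.+1 then minn (hc x') (maxn (enter x') (hd x')).+1 else 0.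

(* Height at which the marking path leaves column [x]'s vertical line. *)
Definition reach x := maxn (enter x) (hd x).

Variables d h : nat.
Hypotheses (hdc : forall x, x < d -> hd x <= hc x).
Hypotheses (hc_mono : forall x, x.+1 < d -> hc x <= hc x.+1).
Hypotheses (hch : forall x, x < d -> hc x <= h).

Lemma reach_le x : x < d -> reach x <= hc x.
Proof.
move=> xd; rewrite /reach geq_max hdc // andbT; case: x xd => //= x xd.
by rewrite geq_min hc_mono.
Qed.

(** Between [enter x] and [reach x] the path climbs line [x]. Each step raises [x + y], which bounds
    the fuel. Only starting points at height [hc x0] matter, since these begin the east steps of
    [C]. *)
Lemma mem_mpath fuel x y x0 : x <= d -> enter x <= y <= h ->
  (x < d -> y <= reach x) -> (d - x) + (h - y) <= fuel ->
  ((x0, hc x0) \in mpath d h hc hd fuel x y) =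
  (x <= x0 < d) && (hc x0 <= reach x0).
Proof.
elim: fuel x y => [|f IHf] x y xd /andP[xy yh] yx fuel_ge /=.
  have -> : x = d by clear -xd fuel_ge; lia.
  by case: (ltnP x0 d) => [|_]; rewrite ?andbF // ltnNge => /negPf->.
have [/andP[/eqP -> _]|nend] := boolP ((x == d) && (y == h)).
  by case: (ltnP x0 d) => [|_]; rewrite ?andbF // ltnNge => /negPf->.
have [dx|x_lt] := leqP d x.
  have xE : x = d by apply/eqP; rewrite eqn_leq xd.
  have yh' : y < h by rewrite ltn_neqAle yh andbT; move: nend; rewrite xE eqxx.
  rewrite IHf // ?(leqW xy) ?yh' //; first by rewrite xE ltnn.
  by clear -fuel_ge yh'; lia.
have yR := yx x_lt; have Rc := reach_le x_lt.
have enterS : enter x.+1 = minn (hc x) (reach x).+1 by [].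
have ch := hch x_lt.
(* East step: [hc x <= y <= reach x <= hc x], so all three are equal. *)
case: ltnP => [cy|yc].
  rewrite in_cons IHf //; first last.
  - by clear -fuel_ge x_lt; lia.
  - move=> _; rewrite /reach enterS; clear -cy yR Rc; lia.
  - by rewrite enterS yh andbT; clear -cy; lia.
  rewrite xpair_eqE; have [->|x0x] := eqVneq x0 x.
    by rewrite ltnn /= orbF leqnn x_lt /=; clear -cy yR Rc; lia.
  by rewrite /= ltn_neqAle eq_sym x0x.
case: ltnP => [yd|dy].
  have dR : hd x <= reach x by rewrite leq_maxr.
  rewrite IHf // ?(leqW xy) //=; first by clear -yc ch; lia.
    by move=> _; apply: leq_trans dR.
  by clear -fuel_ge yd Rc dR ch; lia.
(* Diagonal step: here [y = reach x < hc x], so column [x] contributes no east step. *)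
have Ry : reach x <= y by rewrite geq_max xy dy.
rewrite IHf //; first last.
- by clear -fuel_ge x_lt; lia.
- by move=> _; rewrite /reach enterS; clear -yR Ry yc; lia.
- by rewrite enterS; clear -yR Ry yc ch; lia.
have [->|x0x] := eqVneq x0 x; last by rewrite ltn_neqAle eq_sym x0x.
by rewrite ltnn leqnn x_lt /=; apply/esym/negbTE; rewrite -ltnNge; clear -Ry yc; lia.
Qed.

End Columns.

(** * The automaton computes the marking path *)

Section Marking.
Variables (n : nat) (L C : n.-tuple bool).
Hypotheses (CL : weakly_above C L) (countLC : count id L = count id C).

Lemma weakly_aboveP k : k <= n -> neast C k <= neast L k.
Proof. by move=> kn; have /allP -> := CL; rewrite // mem_iota. Qed.

Let d := count id C.
Let hc := hC C.
Let hd := hD L C.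
Let m k := pending (neast L) (rev (take k C)).

Lemma pending_takeS k : k < n -> m k.+1 =
  if nth false C k then (m k).-1 else minn (m k).+1 (neast L k.+1 - neast C k).
Proof.
move=> kn; rewrite /m (take_nth false) ?size_tuple // rev_rcons /=.
by rewrite size_rev size_takel ?size_tuple ?(ltnW kn) // count_rev.
Qed.

(** Among the columns not yet left by [C], those that the marking path leaves from below the current
    height of [C] are the first [m k]. *)
Lemma reach_pending k : k <= n -> neast C k + m k <= neast L k /\
  forall x, neast C k <= x < d ->
    (reach hc hd x < nnorth C k) = (x < neast C k + m k).
Proof.
elim: k => [_|k IHk kn].
  by rewrite /m /neast /nnorth !take0.
have [mL IHm] := IHk (ltnW kn); have CLk := weakly_aboveP kn.
have kC : k < size C by rewrite size_tuple.
have kL : k < size L by rewrite size_tuple.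
have Lmono := neast_mono L (leqnSn k).
rewrite pending_takeS //; move: CLk; rewrite neastS // nnorthS //.
case: (boolP (nth false C k)) => Ck /=; rewrite ?add0n ?add1n => CLk.
  split; first by clear -mL Lmono CLk; lia.
  move=> x /andP[xk xd]; rewrite IHm ?xd ?(ltnW xk) //.
  by clear -xk; lia.
split; first by clear -mL Lmono CLk; lia.
move=> x /andP[xk xd].
have hd_le z : z < d -> (hd z < (nnorth C k).+1) = (z < neast L k.+1).
  move=> zd; rewrite -ltn_epos ?countLC // /hd /hD.
  have [zk|kz] := ltnP (epos L z) k.+1; first by rewrite ltnS nnorth_mono.
  by apply/negbTE; rewrite -leqNgt; have := nnorth_mono C kz; rewrite nnorthS // Ck.
have hc_ge z : neast C k <= z < d -> nnorth C k < hc z.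
  move=> /andP[kz zd]; have kp : k < epos C z.
    by rewrite ltnNge -ltnS ltn_epos // neastS // (negPf Ck) -leqNgt.
  by have := nnorth_mono C kp; rewrite nnorthS // Ck.
have hc_le z : z < neast C k -> hc z <= nnorth C k.
  move=> zk; have zd : z < d by apply: leq_trans zk (neast_count _ _).
  by apply: nnorth_mono; apply: ltnW; rewrite ltn_epos // ltnW.
have enterS z : enter hc hd z.+1 = minn (hc z) (reach hc hd z).+1 by [].
case: (ltngtP x (neast C k + m k)) => [xm|xm|xE].
- have := IHm x; rewrite xk xd xm => /(_ isT) Rx.
  by rewrite ltnS (ltnW Rx); clear -xm mL Lmono; lia.
(* Past the first unserved column: the preceding column is left from height at least [nnorth C k]
   with room below [C], so the path enters this one strictly higher. *)
- apply: etrans (_ : false = _); last by clear -xm; lia.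
  apply/negbTE; rewrite -leqNgt; case: x xk xd xm => // x xk xd xm.
  have xkd : neast C k <= x < d by clear -xk xd xm; lia.
  have Rx : nnorth C k <= reach hc hd x.
    by rewrite leqNgt IHm // -leqNgt; clear -xm; lia.
  rewrite /reach leq_max enterS leq_min (hc_ge x xkd) /= ltnS.
  by rewrite -/(reach hc hd x) Rx.
(* The first unserved column: the preceding one is left or served, so the entry height is at most
   [nnorth C k] and only [hd x] decides, that is, whether [L] has entered the column. *)
have -> : (x < neast C k + minn (m k).+1 (neast L k.+1 - neast C k)) =
    (x < neast L k.+1) by rewrite xE; clear; lia.
rewrite -hd_le // /reach gtn_max (_ : enter hc hd x < (nnorth C k).+1) //.
rewrite ltnS; case: x xk xd xE => // x xk xd xE; rewrite enterS.
have [xk'|xk'] := ltnP x (neast C k); first by have := hc_le _ xk'; clear; lia.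
have xkd : neast C k <= x < d by rewrite xk' ltnW.
have := IHm x xkd; rewrite (_ : x < neast C k + m k); last by clear -xE; lia.
by clear; lia.
Qed.

Lemma marking_pending j : j < n -> nth false C j ->
  ((neast C j, nnorth C j) \notin marking_east L C) = (0 < m j).
Proof.
move=> jn Cj; have jC : j < size C by rewrite size_tuple.
set x := neast C j; have xE : epos C x = j by apply: epos_neast.
have xd : x < d by have := neast_count C j.+1; rewrite neastS // Cj.
have -> : nnorth C j = hc x by rewrite /hc /hC xE.
have cm z : z.+1 < d -> hc z <= hc z.+1.
  move=> zd; have zd' := ltnW zd; apply: nnorth_mono; apply: ltnW.
  by rewrite ltn_epos ?neast_eposE // ltnW ?epos_size.
have dc z : z < d -> hd z <= hc z.
  (* [L] enters column [z] no later than [C] leaves it. *)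
  move=> zd; apply: nnorth_mono; rewrite -ltnS ltn_epos ?countLC //.
    have pn := epos_size zd; rewrite size_tuple in pn.
    by have := weakly_aboveP pn; rewrite neast_epos.
  by have := epos_size zd; rewrite !size_tuple.
have ch z : z < d -> hc z <= n - d.
  by move=> _; have := nnorth_count C (epos C z); rewrite size_tuple.
have dn : d <= n by rewrite /d -[X in _ <= X](size_tuple C) count_size.
rewrite mem_mpath //; last by clear -dn; lia.
rewrite leq0n xd /= -ltnNge {2}/hc /hC xE; have [_ R] := reach_pending (ltnW jn).
by rewrite R ?leqnn // -[X in X < _]addn0 ltn_add2l.
Qed.

Lemma stL_unmarked : stL L C = unmarked (neast L) (rev C).
Proof.
have stk k x : k <= n -> (x \in unmarked (neast L) (rev (take k C))) =
    (0 < x <= k) && (nth false C x.-1 && (0 < m x.-1)).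
  elim: k => [|k IHk] kn; first by rewrite take0 inE; case: x.
  have sk : size (rev (take k C)) = k.
    by rewrite size_rev size_takel // size_tuple ltnW.
  rewrite (take_nth false) ?size_tuple // rev_rcons in_unmarked sk (IHk (ltnW kn)).
  rewrite -/(m k); have [->|xk] /= := eqVneq x k.+1.
    by rewrite ltnn ltnSn andbT orbF.
  by rewrite !andbF [x <= k.+1]leq_eqVlt (negPf xk).
apply/fsetP => x; rewrite -[in RHS](take_oversize (s := C) (n := n)) ?size_tuple //.
rewrite stk // in_steps; case: x => // j; rewrite /=.
by have [/= jn|//] := ltnP j n; case Cj: nth => //=; rewrite marking_pending.
Qed.

End Marking.

(** * Translation to reversed words and conclusion *)

Lemma Eset_easts n (C : n.-tuple bool) : Eset C = easts (rev C).
Proof.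
have Ek k x : k <= n -> (x \in easts (rev (take k C))) =
    (0 < x <= k) && nth false C x.-1.
  elim: k => [|k IHk] kn; first by rewrite take0 inE; case: x.
  have sk : size (rev (take k C)) = k.
    by rewrite size_rev size_takel // size_tuple ltnW.
  rewrite (take_nth false) ?size_tuple // rev_rcons in_easts sk (IHk (ltnW kn)).
  have [->|xk] /= := eqVneq x k.+1.
    by rewrite ltnn ltnSn andbT orbF.
  by rewrite andbF [x <= k.+1]leq_eqVlt (negPf xk).
apply/fsetP => x; rewrite -[in RHS](take_oversize (s := C) (n := n)) ?size_tuple //.
by rewrite Ek // in_steps.
Qed.

Lemma inPUL_words n d (U L C : n.-tuple bool) :
  inPUL d U L C = (rev C \in words (neast U) (neast L) d n 0).
Proof.
rewrite mem_words size_rev size_tuple eqxx addn0 count_rev /=.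
rewrite /inPUL /inP [RHS]andbC; congr (_ && _).
have Ak k : k <= n -> admissible (neast U) (neast L) (rev (take k C)) =
    all (fun i => neast U i <= neast C i <= neast L i) (iota 0 k.+1).
  elim: k => [|k IHk] kn; first by rewrite take0 /= /neast !take0.
  rewrite -[in RHS]addn1 iotaD all_cat add0n -(IHk (ltnW kn)).
  have sk : size (rev (take k C)) = k.
    by rewrite size_rev size_takel // size_tuple ltnW.
  rewrite (take_nth false) ?size_tuple // rev_rcons /= sk count_rev andbT.
  by rewrite [neast C k.+1]neastS ?size_tuple.
rewrite -(take_oversize (s := C) (n := n)) ?size_tuple // Ak //.
by rewrite /weakly_above -all_predI.
Qed.

Theorem theorem4p8 (n d : nat) (U L : n.-tuple bool) :
  inP d U -> inP d L -> weakly_above U L ->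
  (forall Lam : lam_family, is_Lambda_family Lam ->
     forall C : n.-tuple bool, inPUL d U L C ->
       stL L C = Lam (ground n) (MUL_bases d U L) (Eset C)) /\
  (forall tau : {fset nat},
     Slex (ground n) (MUL_bases d U L) tau <->
     exists2 C : n.-tuple bool, inPUL d U L C & tau = stL L C).
Proof.
move=> dU dL UL.
have hi_mono k : neast L k <= neast L k.+1 by apply: neast_mono.
have wordsP w : w \in words (neast U) (neast L) d n 0 ->
    exists2 C : n.-tuple bool, inPUL d U L C & w = rev C.
  move=> wP; have sw : size (rev w) == n.
    by rewrite size_rev (words_size wP).
  by exists (Tuple sw); rewrite ?inPUL_words /= revK.
have stE C : inPUL d U L C -> stL L C = unmarked (neast L) (rev C).
  move=> /and3P[/eqP dC _ CL]; apply: stL_unmarked CL _.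
  by rewrite dC; apply/eqP.
have -> : MUL_bases d U L = bases (neast U) (neast L) d n 0.
  apply/fsetP => B; apply/imfsetP/basesP => [[C /=]|[w /wordsP[C CP ->] ->]].
    rewrite mem_filter inPUL_words => /andP[CP _] ->.
    by exists (rev C) => //; apply: Eset_easts.
  by exists C; rewrite ?Eset_easts //= mem_filter CP mem_enum.
split=> [Lam LamP C CP|tau].
  rewrite stE // Eset_easts; apply/esym/(Lambda_bases hi_mono LamP).
  by rewrite -inPUL_words.
(* [U] itself provides the word required by [Slex_bases]. *)
have UP : rev U \in words (neast U) (neast L) d n 0.
  rewrite -inPUL_words /inPUL dU UL andbT.
  by apply/allP.
rewrite (Slex_bases hi_mono _ UP); split.
  by case/markingsP=> w /wordsP[C CP ->] ->; exists C; rewrite ?stE.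
case=> C CP ->; apply/markingsP; exists (rev C); last exact: stE.
by rewrite -inPUL_words.
Qed.
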